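(* There is a dense embedding of $\mathbb{P}_0$ into the two-step iteration $\mathbb{F} * \mathbb{M}(\dot{\mathcal{U}})$.
   Context: All filters on $\omega$ are assumed to contain the Fréchet filter. A norm on $x\subseteq\omega$ is a function $\mathrm{nor}:[x]^{<\omega}\to\omega$ such that (1) $\mathrm{nor}(s)>0$ implies $|s|>1$; (2) $s\subseteq t$ implies $\mathrm{nor}(s)\le\mathrm{nor}(t)$; (3) if $n>0$, $\mathrm{nor}(s)\ge n$ and $s=s_0\cup s_1$, then $\mathrm{nor}(s_i)\ge n-1$ for some $i\in 2$. A creature is a pair $c=\langle s_c,\mathrm{nor}_c\rangle$ with $s_c$ a nonempty finite subset of $\omega$ and $\mathrm{nor}_c$ a norm on $s_c$ with $\mathrm{nor}_c(s_c)>0$; $c<d$ means $\max s_c<\min s_d$ and $\mathrm{nor}_c(s_c)<\mathrm{nor}_d(s_d)$. A $0$-condition is $p=\langle s^p,\langle c^p_n:n\in\omega\rangle\rangle$ with $s^p\in[\omega]^{<\omega}$, each $c^p_n$ a creature, $c^p_n<c^p_{n+1}$, and every element of $s^p$ below $\min s^p_0$, where $s^p_n, \mathrm{nor}^p_n$ denote $s_{c^p_n},\mathrm{nor}_{c^p_n}$; $\mathrm{int}(p)=\bigcup_n s^p_n$. For $0$-conditions, $q\le p$ means: (7) $s^q\supseteq s^p$ and $s^q\setminus s^p\subseteq\mathrm{int}(p)$; (8) letting $n_0$ be least such that $s^p_m\cap s^q=\emptyset$ for all $m\ge n_0$, there is a strictly increasing sequence $\langle i_n:n\in\omega\rangle$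 with $i_0=n_0$ such that $s^q_n\subseteq\bigcup_{m\in[i_n,i_{n+1})}s^p_m$ for all $n$; (9) for all $n$ and $t\subseteq s^q_n$ with $\mathrm{nor}^q_n(t)>0$ there is $m$ with $\mathrm{nor}^p_m(t\cap s^p_m)>0$. $\mathbb{P}_0$ is the set of $0$-conditions ordered by $\le$. $\mathbb{F}$ is the set of all proper $F_\sigma$ filters on $\omega$ (as subsets of $\mathcal{P}(\omega)\cong 2^\omega$), ordered by reverse inclusion ($\mathcal{F}'\le\mathcal{F}$ iff $\mathcal{F}'\supseteq\mathcal{F}$); it adds an ultrafilter on $\omega$, and $\dot{\mathcal{U}}$ is the canonical $\mathbb{F}$-name for it. For a filter $\mathcal{U}$, $\mathbb{M}(\mathcal{U})$ is Mathias–Prikry forcing: conditions $\langle s,A\rangle$ with $s\in[\omega]^{<\omega}$, $A\in\mathcal{U}$, $\max s<\min A$, ordered by $\langle t,B\rangle\le\langle s,A\rangle$ iff $t\supseteq s$, $t\setminus s\subseteq A$, $B\subseteq A$. *)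

(* Defs.v *)
From mathcomp Require Import all_boot finmap.
From mathcomp Require Import all_classical all_reals all_analysis borel_hierarchy.

Set Implicit Arguments.
Unset Strict Implicit.
Unset Printing Implicit Defensive.

Local Open Scope classical_set_scope.

(** * Orders, read as forcing notions: [le q p] means that q extends p *)

Definition compatible (P : Type) (le : P -> P -> Prop) (p q : P) : Prop :=
  exists r, le r p /\ le r q.

Definition dense_embedding (P Q : Type) (leP : P -> P -> Prop)
    (leQ : Q -> Q -> Prop) (i : P -> Q) : Prop :=
  [/\ forall p p', leP p' p -> leQ (i p') (i p),
      forall p p', ~ compatible leP p p' -> ~ compatible leQ (i p) (i p')
    & forall q, exists p, leQ (i p) q].

(** * Names and the forcing relation *)

(* The name [Name c x] is the set of pairs {(x i, c i) : i in I}. *)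
Inductive name (P : Type) : Type :=
  Name (I : Type) (c : I -> P) (x : I -> name P).

(* Ground-model sets: [GSet x] is the set {x i : i in I}. *)
Inductive gset : Type := GSet (I : Type) (x : I -> gset).

(* Name with all elements of the family x as members.  Each of them is paired
   with every condition, since P is not assumed to have a largest element. *)
Definition full_name (P I : Type) (x : I -> name P) : name P :=
  @Name P (I * P)%type snd (fun ip => x ip.1).

Fixpoint check (P : Type) (a : gset) : name P :=
  let: GSet K x := a in @full_name P K (fun i => check P (x i)).

(* von Neumann numerals *)
Fixpoint nat_gset (n : nat) : gset :=
  if n is m.+1 then
    let: GSet K x := nat_gset m in
    @GSet (option K) (fun o => if o is Some i then x i else GSet x)
  else @GSet Empty_set (fun e => match e with end).

Definition set_gset (A : set nat) : gset :=
  @GSet {n | A n} (fun n => nat_gset (sval n)).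

Definition omega_name (P : Type) : name P := check P (set_gset setT).

(* Names for {a, b} and for the Kuratowski pair {{a}, {a, b}} *)
Definition upair_name (P : Type) (a b : name P) : name P :=
  @full_name P bool (fun i => if i then a else b).

Definition pair_name (P : Type) (a b : name P) : name P :=
  upair_name (upair_name a a) (upair_name a b).

(* Formulas of the forcing language, with names as parameters and binders
   represented by functions on names *)
Inductive formula (P : Type) : Type :=
| FEq (x y : name P)
| FMem (x y : name P)
| FNot (f : formula P)
| FAnd (f g : formula P)
| FImp (f g : formula P)
| FAll (f : name P -> formula P)
| FEx (f : name P -> formula P).

Section Forcing.
Context (P : Type) (le : P -> P -> Prop).

(* p forces x = y when every member of x is forced to be in y and conversely;
   membership is unfolded as in [forces_mem] to keep the recursion structural *)
Fixpoint forces_eq (x y : name P) (p : P) {struct x} : Prop :=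
  let: Name K c x' := x in
  let: Name J d y' := y in
  (forall i q, le q p -> le q (c i) ->
     exists r, le r q /\ exists j, le r (d j) /\ forces_eq (x' i) (y' j) r) /\
  (forall j q, le q p -> le q (d j) ->
     exists r, le r q /\ exists i, le r (c i) /\ forces_eq (x' i) (y' j) r).

Definition forces_mem (x y : name P) (p : P) : Prop :=
  let: Name J d y' := y in
  forall q, le q p ->
    exists r, le r q /\ exists j, le r (d j) /\ forces_eq x (y' j) r.

Fixpoint forces (p : P) (f : formula P) : Prop :=
  match f with
  | FEq x y => forces_eq x y p
  | FMem x y => forces_mem x y p
  | FNot f => forall q, le q p -> ~ forces q f
  | FAnd f g => forces p f /\ forces p g
  | FImp f g => forall q, le q p -> forces q f -> forces q g
  | FAll f => forall x, forces p (f x)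
  | FEx f => forall q, le q p -> exists r, le r q /\ exists x, forces r (f x)
  end.

End Forcing.

Definition FIff (P : Type) (f g : formula P) := FAnd (FImp f g) (FImp g f).
Definition FAllIn (P : Type) (a : name P) (f : name P -> formula P) :=
  FAll (fun x => FImp (FMem x a) (f x)).
Definition FExIn (P : Type) (a : name P) (f : name P -> formula P) :=
  FEx (fun x => FAnd (FMem x a) (f x)).
Definition FSub (P : Type) (a b : name P) := FAllIn a (fun x => FMem x b).

(* The second coordinate of the iteration is given by formulas Q, "x is a
   condition", and R, "x extends y".  All names x with p ||- Q(x) are used. *)
Definition two_step (P : Type) (le : P -> P -> Prop)
    (Q : name P -> formula P) : Type :=
  {px : P * name P | forces le px.1 (Q px.2)}.

Definition two_step_le (P : Type) (le : P -> P -> Prop)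
    (Q : name P -> formula P) (R : name P -> name P -> formula P)
    (u v : two_step le Q) : Prop :=
  le (sval u).1 (sval v).1 /\ forces le (sval u).1 (R (sval u).2 (sval v).2).

(** * Mathias-Prikry forcing in the forcing language *)

Definition FBijection (P : Type) (h n s : name P) : formula P :=
  FAnd (FAllIn h (fun z => FExIn n (fun i => FExIn s (fun j =>
          FEq z (pair_name i j)))))
 (FAnd (FAllIn n (fun i => FExIn s (fun j => FAllIn s (fun j' =>
          FIff (FMem (pair_name i j') h) (FEq j' j)))))
       (FAllIn s (fun j => FExIn n (fun i => FAllIn n (fun i' =>
          FIff (FMem (pair_name i' j) h) (FEq i' i)))))).

Definition FFinite (P : Type) (s : name P) : formula P :=
  FExIn (omega_name P) (fun n => FEx (fun h => FBijection h n s)).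

(* On von Neumann numerals, i < j is i \in j. *)
Definition mathias_cond (P : Type) (U x : name P) : formula P :=
  FEx (fun s => FEx (fun A =>
    FAnd (FEq x (pair_name s A))
   (FAnd (FAnd (FSub s (omega_name P)) (FFinite s))
   (FAnd (FMem A U)
         (FAllIn s (fun i => FAllIn A (fun j => FMem i j))))))).

Definition mathias_le (P : Type) (y x : name P) : formula P :=
  FEx (fun t => FEx (fun B => FEx (fun s => FEx (fun A =>
    FAnd (FAnd (FEq y (pair_name t B)) (FEq x (pair_name s A)))
   (FAnd (FSub s t)
   (FAnd (FAllIn t (fun i => FImp (FNot (FMem i s)) (FMem i A)))
         (FSub B A))))))).

(** * F_sigma filters *)

(* A subset n |-> x n of omega is identified with a point x of Cantor space. *)
Definition Fsigma_system (F : set_system nat) : Prop :=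
  Fsigma [set x : cantor_space | F [set n | x n]].

Definition Fsigma_filter : Type :=
  {F : set_system nat | [/\ ProperFilter F, \oo `<=` F & Fsigma_system F]}.

Definition Fsigma_filter_le (F' F : Fsigma_filter) : Prop :=
  sval F `<=` sval F'.

(* The canonical name {(A^, F) : A \in F} for the union of the generic *)
Definition generic_name : name Fsigma_filter :=
  @Name Fsigma_filter {FA : Fsigma_filter * set nat | sval FA.1 FA.2}
    (fun FA => (sval FA).1)
    (fun FA => check Fsigma_filter (set_gset (sval FA).2)).

(** * Creatures and 0-conditions *)

(* [nor] is a total function, but only its values at the finite subsets of x
   are constrained or ever used. *)
Definition is_norm (x : set nat) (nor : {fset nat} -> nat) : Prop :=
  [/\ forall s : {fset nat}, [set` s] `<=` x -> 0 < nor s -> 1 < #|` s|,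
      forall s t : {fset nat}, [set` t] `<=` x -> (s `<=` t)%fset -> nor s <= nor t
    & forall (n : nat) (s s0 s1 : {fset nat}), [set` s] `<=` x ->
        0 < n -> n <= nor s -> s = (s0 `|` s1)%fset ->
        n.-1 <= nor s0 \/ n.-1 <= nor s1].

Record creature : Type := Creature {
  cset : {fset nat};
  cnor : {fset nat} -> nat;
  cset_neq0 : cset != fset0%fset;
  cnor_is_norm : is_norm [set` cset] cnor;
  cnor_gt0 : 0 < cnor cset }.

Definition creature_lt (c d : creature) : Prop :=
  (forall i j, i \in cset c -> j \in cset d -> i < j) /\
  cnor c (cset c) < cnor d (cset d).

Record cond0 : Type := Cond0 {
  stem : {fset nat};
  creat : nat -> creature;
  creat_lt : forall n, creature_lt (creat n) (creat n.+1);
  stem_lt : forall i j, i \in stem -> j \in cset (creat 0) -> i < j }.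

Definition cset_at (p : cond0) (n : nat) : {fset nat} := cset (creat p n).
Definition cnor_at (p : cond0) (n : nat) : {fset nat} -> nat :=
  cnor (creat p n).

Definition cond0_int (p : cond0) : set nat :=
  [set k | exists n, k \in cset_at p n].

Definition cond0_le (q p : cond0) : Prop :=
  [/\ (stem p `<=` stem q)%fset /\
        (forall k, k \in stem q -> k \notin stem p -> cond0_int p k),
      exists i : nat -> nat,
        [/\ forall n, i n < i n.+1,
            (forall m, i 0 <= m -> (cset_at p m `&` stem q = fset0)%fset) /\
              (forall n0, (forall m, n0 <= m ->
                 (cset_at p m `&` stem q = fset0)%fset) -> i 0 <= n0)
          & forall n k, k \in cset_at q n ->
              exists m, i n <= m < i n.+1 /\ k \in cset_at p m]
    & forall n (t : {fset nat}), (t `<=` cset_at q n)%fset -> 0 < cnor_at q n t ->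
        exists m, 0 < cnor_at p m (t `&` cset_at p m)%fset].

(* Main.v *)
(* For a 0-condition p call T null if nor^p_n(s^p_n `&` T) = 0 for all n, and let
   F_p be the dual filter of the ideal generated by the null sets.  The axioms of
   norms bound the norm of a union of 2^k null sets by k, so F_p is proper, and by
   compactness of Cantor space it is F_sigma.  The embedding sends p to
   (F_p, (s^p, int p)).  Clause (9) says exactly that p-null sets stay null in an
   extension q, whence F_p `<=` F_q.

   Conversely, a condition (F, x) of the iteration can be extended to decide x as
   (t, B) with B in F: the name of the generic filter only contains ground-model
   sets.  Writing F as an increasing union of closed sets C_n, let the n-th
   creature be a finite part of B, with norm the least k such that the given set is
   covered by 2^k sets, each a singleton or disjoint from a member of C_n.  Compactness yields
   arbitrarily large norms because B is in F.  This produces a 0-condition r with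
   stem t, int r `<=` B and F `<=` F_r; if the p-null sets are also given norm 0,
   then r extends p, which gives preservation of incompatibility. *)
Require Import Defs.
From mathcomp Require Import all_boot finmap.
From mathcomp Require Import all_classical all_analysis borel_hierarchy.

Set Implicit Arguments.
Unset Strict Implicit.
Unset Printing Implicit Defensive.

Local Open Scope classical_set_scope.

(** * The forcing relation *)

Section ForcingFacts.
Context (P : Type) (le : P -> P -> Prop).
Hypothesis le_refl : forall p, le p p.
Hypothesis le_trans : forall q p r, le p q -> le q r -> le p r.
Implicit Types (p q r : P) (x y z a b c d : name P) (S T : set nat).

(** The common shape of forced membership and forced existence; [densely_bind] chains such
    statements. *)
Definition densely (Q : P -> Prop) p :=
  forall q, le q p -> exists r, le r q /\ Q r.

Lemma densely_bind (Q Q' : P -> Prop) p :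
  densely Q p -> (forall q, le q p -> Q q -> densely Q' q) -> densely Q' p.
Proof.
move=> dQ QQ' q qp; have [r [rq Qr]] := dQ q qp.
have [r' [r'r Q'r']] := QQ' r (le_trans rq qp) Qr r (le_refl r).
by exists r'; split => //; apply: le_trans r'r rq.
Qed.

Lemma denselyW (Q : P -> Prop) p : (forall q, le q p -> Q q) -> densely Q p.
Proof. by move=> Qp q qp; exists q; split => //; apply: Qp. Qed.

Lemma densely_inh (Q : P -> Prop) p : densely Q p -> exists2 r, le r p & Q r.
Proof. by move=> /(_ p (le_refl p)) [r [rp Qr]]; exists r. Qed.

Local Notation feq := (forces_eq le).
Local Notation fmem := (forces_mem le).

Lemma feq_mono x y p q : le q p -> feq x y p -> feq x y q.
Proof.
by case: x y => [K c x] [J d y] qp /= [H1 H2]; split => i r rq;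
  [apply: H1 | apply: H2]; apply: le_trans rq qp.
Qed.

Lemma fmem_mono x y p q : le q p -> fmem x y p -> fmem x y q.
Proof. by case: y => J d y qp /= H r rq; apply: H; apply: le_trans rq qp. Qed.

(** Both clauses of [forces_eq] already allow a further extension, so one may first pass to an r
    below q. *)
Lemma feq_dense x y p : densely (feq x y) p -> feq x y p.
Proof.
case: x y => [K c x] [J d y] H; split => i q qp qc;
  have [r [rq [H1 H2]]] := H q qp;
  have rc := le_trans rq qc.
- have [r' [r'r H']] := H1 i r (le_refl r) rc.
  by exists r'; split => //; apply: le_trans r'r rq.
- have [r' [r'r H']] := H2 i r (le_refl r) rc.
  by exists r'; split => //; apply: le_trans r'r rq.
Qed.

Lemma fmem_dense x y p : densely (fmem x y) p -> fmem x y p.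
Proof.
case: y => J d y H; apply: (densely_bind H) => q _ Hq; exact: Hq.
Qed.

Lemma feq_refl x p : feq x x p.
Proof.
elim: x p => K c x IH p /=; split => i q qp qc; exists q; split => //;
  by exists i; split.
Qed.

Lemma feq_sym x y p : feq x y p -> feq y x p.
Proof.
elim: x y p => K c x IH [J d y] p /= [H1 H2]; split => i q qp qc.
- have [r [rq [j [rj e]]]] := H2 i q qp qc.
  by exists r; split => //; exists j; split => //; apply: IH.
- have [r [rq [j [rj e]]]] := H1 i q qp qc.
  by exists r; split => //; exists j; split => //; apply: IH.
Qed.

Lemma feq_trans y x z p : feq x y p -> feq y z p -> feq x z p.
Proof.
elim: x y z p => K c x IH [J d y] [L e z] p /= [H1 H2] [G1 G2].
split => i q qp qc.
- have [r [rq [j [rj E]]]] := H1 i q qp qc.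
  have [r' [r'r [l [rl E']]]] := G1 j r (le_trans rq qp) rj.
  exists r'; split; first exact: le_trans r'r rq.
  exists l; split => //; apply: (IH _ (y j)) => //; exact: feq_mono E.
- have [r [rq [j [rj E]]]] := G2 i q qp qc.
  have [r' [r'r [l [rl E']]]] := H2 j r (le_trans rq qp) rj.
  exists r'; split; first exact: le_trans r'r rq.
  exists l; split => //; apply: (IH _ (y j)) => //; exact: feq_mono E.
Qed.

Lemma fmem_congl x' x y p : feq x x' p -> fmem x y p -> fmem x' y p.
Proof.
case: y => J d y E H q qp; have [r [rq [j [rj Ej]]]] := H q qp.
exists r; split => //; exists j; split => //.
apply: (feq_trans _ Ej); apply: feq_sym; apply: feq_mono E.
exact: le_trans rq qp.
Qed.

Lemma fmem_congr y y' x p : feq y y' p -> fmem x y p -> fmem x y' p.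
Proof.
case: y y' => [J d y] [J' d' y'] /= [E _] H.
apply: (densely_bind H) => q qp [j [qj Ej]] r rq.
have [r' [r'r [l [rl E']]]] := E j r (le_trans rq qp) (le_trans rq qj).
exists r'; split => //; exists l; split => //.
by apply: feq_trans E'; apply: feq_mono Ej; apply: le_trans r'r rq.
Qed.

(** Each component of a name is forced into that name below its own condition. Carried to the other
    name, this membership is, up to symmetry, the clause that [forces_eq] asks for. *)
Lemma feq_ext x y p :
  (forall q z, le q p -> fmem z x q <-> fmem z y q) -> feq x y p.
Proof.
case: x y => [K c x] [J d y] H; split => i q qp qc.
- have /H : fmem (x i) (Name c x) q.
    move=> r rq; exists r; split => //; exists i; split; last exact: feq_refl.
    exact: le_trans rq qc.
  by move=> /(_ qp) /(_ q (le_refl q)).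
- have /H : fmem (y i) (Name d y) q.
    move=> r rq; exists r; split => //; exists i; split; last exact: feq_refl.
    exact: le_trans rq qc.
  move=> /(_ qp) /(_ q (le_refl q)) [r [rq [j [rj E]]]].
  by exists r; split => //; exists j; split => //; apply: feq_sym.
Qed.

(** * Membership in full names; unordered and ordered pairs *)

Lemma fmem_full (I : Type) (y : I -> name P) x p :
  fmem x (full_name y) p <-> densely (fun r => exists i, feq x (y i) r) p.
Proof.
split=> H q qp; have [r [rq]] := H q qp.
- by move=> [[i r'] [_ E]]; exists r; split => //; exists i.
- by move=> [i E]; exists r; split => //; exists (i, r).
Qed.

Lemma fmem_full_intro (I : Type) (y : I -> name P) x p i :
  feq x (y i) p -> fmem x (full_name y) p.
Proof.
by move=> E; apply/fmem_full/denselyW => q qp; exists i; apply: feq_mono E.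
Qed.

Lemma fmem_upair z a b p :
  fmem z (upair_name a b) p <-> densely (fun r => feq z a r \/ feq z b r) p.
Proof.
split=> [/fmem_full H|H].
  by apply: (densely_bind H) => q _ [[] E]; apply: denselyW => r rq;
    [left|right]; apply: feq_mono E.
by apply/fmem_full; apply: (densely_bind H) => q _ [] E;
  apply: denselyW => r rq; [exists true|exists false]; apply: feq_mono E.
Qed.

Lemma fmem_upairl a b p : fmem a (upair_name a b) p.
Proof. by apply: (@fmem_full_intro _ _ _ _ true); apply: feq_refl. Qed.

Lemma fmem_upairr a b p : fmem b (upair_name a b) p.
Proof. by apply: (@fmem_full_intro _ _ _ _ false); apply: feq_refl. Qed.

Arguments fmem_upairl : clear implicits.
Arguments fmem_upairr : clear implicits.

Lemma upair_congr a b a' b' p :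
  feq a a' p -> feq b b' p -> feq (upair_name a b) (upair_name a' b') p.
Proof.
move=> Ea Eb; apply: feq_ext => q z qp; split=> /fmem_upair H;
  apply/fmem_upair; apply: (densely_bind H) => r rq [] E;
  apply: denselyW => r' r'r; have r'p := le_trans r'r (le_trans rq qp);
  [left|right|left|right]; apply: (feq_trans (feq_mono r'r E)) => //.
- exact: feq_mono Ea.
- exact: feq_mono Eb.
- by apply: feq_sym; apply: feq_mono Ea.
- by apply: feq_sym; apply: feq_mono Eb.
Qed.

Lemma pair_congr a b a' b' p :
  feq a a' p -> feq b b' p -> feq (pair_name a b) (pair_name a' b') p.
Proof. by move=> Ea Eb; apply: upair_congr; apply: upair_congr. Qed.

Lemma upair_subr a b c d p : fmem (upair_name a b) (pair_name c d) p ->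
  densely (fun r => feq b c r \/ feq b d r) p.
Proof.
move=> /fmem_upair H; apply: (densely_bind H) => q qp [] E.
- have /fmem_upair H' := fmem_congr E (fmem_upairr _ _ _).
  by apply: (densely_bind H') => r rq [] E'; apply: denselyW => r' r'r; left;
    apply: feq_mono E'.
- exact/fmem_upair/(fmem_congr E (fmem_upairr _ _ _)).
Qed.

(** The Kuratowski argument, run densely. The set {a} is {c} or {c, d}, so c = a. Then b is c or d,
    and d is a or b; if b = c and d = a, all four names agree. *)
Lemma pair_inj a b c d p : feq (pair_name a b) (pair_name c d) p ->
  feq a c p /\ feq b d p.
Proof.
move=> E.
have Eac : feq a c p.
  apply: feq_dense.
  have /fmem_upair H := fmem_congr E (fmem_upairl _ _ _).
  apply: (densely_bind H) => q qp H'.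
  have: fmem c (upair_name a a) q.
    by case: H' => E'; apply: (fmem_congr (feq_sym E')); apply: fmem_upairl.
  move=> /fmem_upair H2; apply: (densely_bind H2) => r rq.
  by case=> E'; apply: denselyW => r' r'r; apply: feq_sym; apply: feq_mono E'.
split=> //.
have Hb := upair_subr (fmem_congr E (fmem_upairr _ _ _)).
have Hd := upair_subr (fmem_congr (feq_sym E) (fmem_upairr _ _ _)).
apply: feq_dense; apply: (densely_bind Hb) => q qp [Ebc|Ebd]; last first.
  by apply: denselyW => r rq; apply: feq_mono Ebd.
move=> r rq; have [r' [r'r Er']] := Hd r (le_trans rq qp).
exists r'; split => //; case: Er' => Er'; last exact: feq_sym.
have r'q := le_trans r'r rq.
apply: (feq_trans (feq_mono r'q Ebc)); apply: feq_sym.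
by apply: (feq_trans Er'); apply: feq_mono Eac; apply: le_trans r'q qp.
Qed.

(** * Numerals and canonical names of ground-model sets *)

Definition num n : name P := check P (nat_gset n).

Definition cset_name S : name P := check P (set_gset S).

Lemma fmem_cset x S p :
  fmem x (cset_name S) p <->
  densely (fun r => exists2 n, S n & feq x (num n) r) p.
Proof.
have -> : cset_name S = full_name (fun i : {n | S n} => num (sval i)) by [].
split=> [/fmem_full|] H.
  apply: (densely_bind H) => q _ [[n Sn] E].
  by apply: denselyW => r rq; exists n => //; apply: feq_mono E.
apply/fmem_full; apply: (densely_bind H) => q _ [n Sn E].
by apply: denselyW => r rq; exists (exist _ n Sn); apply: feq_mono E.
Qed.

(** The index type of [nat_gset n] is buried in the recursion; hiding it behind [K] leaves the
    members described by value. *)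
Lemma nat_gsetE n : exists K (x : K -> gset), [/\ nat_gset n = GSet x,
  forall i, exists2 k, k < n & x i = nat_gset k &
  forall k, k < n -> exists i, x i = nat_gset k].
Proof.
elim: n => [|n [K [x [E H1 H2]]]] /=.
  by exists Empty_set, (Empty_set_rect (fun=> gset)); split=> // -[].
rewrite E; exists (option K), (fun o => if o is Some i then x i else GSet x).
split=> // [[i|]|k].
- by have [k kn ->] := H1 i; exists k => //; apply: ltnW.
- by exists n.
- rewrite ltnS leq_eqVlt => /predU1P[->|/H2 [i Ei]]; first by exists None.
  by exists (Some i).
Qed.

Lemma fmem_num x n p :
  fmem x (num n) p <-> densely (fun r => exists2 k, k < n & feq x (num k) r) p.
Proof.
have [K [f [En H1 H2]]] := nat_gsetE n.
have -> : num n = full_name (fun i => check P (f i)) by rewrite /num En.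
split=> [/fmem_full|] H.
  apply: (densely_bind H) => q _ [i E]; have [k kn e] := H1 i.
  by apply: denselyW => r rq; exists k => //; rewrite /num -e; apply: feq_mono E.
apply/fmem_full; apply: (densely_bind H) => q _ [k kn E].
have [i e] := H2 k kn.
by apply: denselyW => r rq; exists i; rewrite e; apply: feq_mono E.
Qed.

(** Descent in place of foundation: if n is forced into n, some extension forces n = k with k < n,
    and hence k into k. *)
Lemma fmem_num_irr n p : ~ fmem (num n) (num n) p.
Proof.
elim/ltn_ind: n p => n IH p /fmem_num /densely_inh [r rp [k kn E]].
apply: (IH k kn r); apply: (fmem_congr E).
by apply/fmem_num/denselyW => q qr; exists k => //; apply: feq_refl.
Qed.

(** For m < n the numeral m is a member of n, so forced equality would put m into itself. This turns
    forced facts about numerals into true ones. *)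
Lemma num_inj m n p : feq (num m) (num n) p -> m = n.
Proof.
wlog mn : m n / m < n => [H E|E].
  case: (ltngtP m n) => // [mn|nm]; first exact: H E.
  by apply/esym/H => //; apply: feq_sym.
exfalso; apply: (@fmem_num_irr m p); apply: (fmem_congr (feq_sym E)).
by apply/fmem_num/denselyW => q qr; exists m => //; apply: feq_refl.
Qed.

Lemma fmem_cset_intro n S x p :
  S n -> feq x (num n) p -> fmem x (cset_name S) p.
Proof.
by move=> Sn E; apply/fmem_cset/denselyW => q qp; exists n => //; apply: feq_mono E.
Qed.

Lemma fmem_num_intro k n x p : k < n -> feq x (num k) p -> fmem x (num n) p.
Proof.
by move=> kn E; apply/fmem_num/denselyW => q qp; exists k => //; apply: feq_mono E.
Qed.

Lemma fmem_num_cset n S p : fmem (num n) (cset_name S) p -> S n.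
Proof. by move=> /fmem_cset /densely_inh [r _ [k Sk /num_inj ->]]. Qed.

Lemma forces_sub_cset S T p : S `<=` T ->
  forces le p (FSub (cset_name S) (cset_name T)).
Proof.
move=> ST x q qp /fmem_cset H; apply/fmem_cset; apply: (densely_bind H).
by move=> r rq [n Sn E]; apply: denselyW => r' r'r; exists n;
  [apply: ST | apply: feq_mono E].
Qed.

(** The name h pairs each index below [size l] with the entry there of a duplicate-free enumeration
    l of s. *)
Lemma forces_finite_cset (s : {fset nat}) p :
  forces le p (FFinite (cset_name [set` s])).
Proof.
pose l := enum_fset s.
have mem_l n : n \in s = (n \in l) by [].
have lu : uniq l by apply: fset_uniq.
pose h := full_name (fun i : 'I_(size l) => pair_name (num i) (num (nth 0 l i))).
have hE z q : fmem z h q <-> densely (fun r => exists2 k, k < size l &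
    feq z (pair_name (num k) (num (nth 0 l k))) r) q.
  split=> [/fmem_full|] H.
    apply: (densely_bind H) => r _ [i E].
    by apply: denselyW => r' rq; exists i => //; apply: feq_mono E.
  apply/fmem_full; apply: (densely_bind H) => r _ [k kn E].
  by apply: denselyW => r' rq; exists (Ordinal kn); apply: feq_mono E.
have nth_s k : k < size l -> [set` s] (nth 0 l k).
  by move=> kl; rewrite /= mem_l mem_nth.
have sP x q : fmem x (cset_name [set` s]) q ->
  densely (fun r => exists2 k, k < size l & feq x (num (nth 0 l k)) r) q.
  move=> /fmem_cset H; apply: (densely_bind H) => r _ [n sn E].
  apply: denselyW => r' r'r; exists (index n l); first by rewrite index_mem.
  by rewrite nth_index //; apply: feq_mono E.
move=> q qp; exists q; split => //; exists (num (size l)); split.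
  by apply: fmem_cset_intro (feq_refl _ _).
move=> r rq; exists r; split => //; exists h; split; [|split].
- move=> z r1 r1r /(hE z r1) H r2 r2r1.
  have [r3 [r3r2 [k kl E]]] := H r2 r2r1.
  exists r3; split => //; exists (num k); split.
    exact: fmem_num_intro kl (feq_refl _ _).
  move=> r4 r4r3; exists r4; split => //; exists (num (nth 0 l k)); split.
    by apply: fmem_cset_intro (feq_refl _ _); apply: nth_s.
  exact: feq_mono E.
- move=> x r1 r1r /fmem_num H r2 r2r1.
  have [r3 [r3r2 [k kl E]]] := H r2 r2r1.
  exists r3; split => //; exists (num (nth 0 l k)); split.
    by apply: fmem_cset_intro (feq_refl _ _); apply: nth_s.
  move=> y r4 r4r3 /(sP y r4) H4; split=> r5 r5r4.
  + move=> /(hE _ r5) H5; apply: feq_dense; apply: (densely_bind H5) => r6 r6r5.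
    move=> [k' k'l] /pair_inj [Ex Ey].
    have r63 : le r6 r3 by apply: (le_trans r6r5); apply: le_trans r5r4 r4r3.
    have -> : k = k'.
      apply: (@num_inj _ _ r6); apply: feq_trans Ex; apply: feq_sym.
      exact: feq_mono E.
    by apply: denselyW => r7 r76; apply: feq_mono Ey.
  + move=> Ey; apply/hE; apply: denselyW => r6 r6r5; exists k => //.
    apply: pair_congr; last exact: feq_mono Ey.
    apply: feq_mono E; apply: (le_trans r6r5); exact: le_trans r5r4 r4r3.
- move=> x r1 r1r /(sP x r1) H r2 r2r1.
  have [r3 [r3r2 [k kl E]]] := H r2 r2r1.
  exists r3; split => //; exists (num k); split.
    exact: fmem_num_intro kl (feq_refl _ _).
  move=> y r4 r4r3 _; split=> r5 r5r4.
  + move=> /(hE _ r5) H5; apply: feq_dense; apply: (densely_bind H5) => r6 r6r5.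
    move=> [k' k'l] /pair_inj [Ey Ex].
    have r63 : le r6 r3 by apply: (le_trans r6r5); apply: le_trans r5r4 r4r3.
    (* Injectivity: equal entries of the duplicate-free l sit at equal indices. *)
    have/eqP : nth 0 l k = nth 0 l k'.
      apply: (@num_inj _ _ r6); apply: feq_trans Ex; apply: feq_sym.
      exact: feq_mono E.
    rewrite nth_uniq // => /eqP ->.
    by apply: denselyW => r7 r76; apply: feq_mono Ey.
  + move=> Ey; apply/hE; apply: denselyW => r6 r6r5; exists k => //.
    apply: pair_congr; first exact: feq_mono Ey.
    apply: feq_mono E; apply: (le_trans r6r5); exact: le_trans r5r4 r4r3.
Qed.

(** * Mathias-Prikry conditions and their order in the forcing language *)

Lemma forces_mathias_cond (U : name P) (s : {fset nat}) A p :
  (forall i j, i \in s -> A j -> i < j) -> fmem (cset_name A) U p ->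
  forces le p (mathias_cond U (pair_name (cset_name [set` s]) (cset_name A))).
Proof.
move=> sA AU q qp; exists q; split => //; exists (cset_name [set` s]).
move=> r rq; exists r; split => //; exists (cset_name A).
have rp := le_trans rq qp.
split; first exact: feq_refl.
split; first by split; [apply: forces_sub_cset | apply: forces_finite_cset].
split; first exact: fmem_mono AU.
(* Both members are densely decided as numerals i and j, for which i < j is membership. *)
move=> x r1 r1r /fmem_cset Hx y r2 r2r1 /fmem_cset Hy.
apply: (@fmem_dense x y r2); apply: (densely_bind Hy) => r3 r32 [j Aj Ej] r4 r43.
have r41 : le r4 r1 by apply: (le_trans r43); apply: le_trans r32 r2r1.
have [r5 [r54 [i si Ei]]] := Hx r4 r41.
exists r5; split => //.
apply: (fmem_congr (feq_sym (feq_mono (le_trans r54 r43) Ej))).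
by apply: fmem_num_intro Ei; apply: sA.
Qed.

Lemma forces_mathias_le x y (s t : {fset nat}) A B p :
  feq y (pair_name (cset_name [set` t]) (cset_name B)) p ->
  feq x (pair_name (cset_name [set` s]) (cset_name A)) p ->
  [set` s] `<=` [set` t] -> (forall k, k \in t -> k \notin s -> A k) ->
  B `<=` A -> forces le p (mathias_le y x).
Proof.
move=> Ey Ex st tsA BA.
move=> q1 q1p; exists q1; split => //; exists (cset_name [set` t]).
move=> q2 q21; exists q2; split => //; exists (cset_name B).
move=> q3 q32; exists q3; split => //; exists (cset_name [set` s]).
move=> q4 q43; exists q4; split => //; exists (cset_name A).
have q4p := le_trans q43 (le_trans q32 (le_trans q21 q1p)).
split; first by split; [apply: feq_mono Ey|apply: feq_mono Ex].
split; first exact: forces_sub_cset.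
split; last exact: forces_sub_cset.
move=> z r rq /fmem_cset Hz r1 r1r nz.
apply: (@fmem_dense z _ r1) => r2 r21.
have [r3 [r32 [k tk Ek]]] := Hz r2 (le_trans r21 r1r).
exists r3; split => //; apply: (fmem_cset_intro _ Ek).
apply: tsA => //; apply/negP => sk; apply: (nz r3 (le_trans r32 r21)).
exact: fmem_cset_intro Ek.
Qed.

(** [pair_inj] identifies the names witnessing the forced order with the four given canonical names;
    membership of a numeral in a canonical name is then a ground-model fact. *)
Lemma forces_mathias_le_inv x y (s t : {fset nat}) A B p :
  feq y (pair_name (cset_name [set` t]) (cset_name B)) p ->
  feq x (pair_name (cset_name [set` s]) (cset_name A)) p ->
  forces le p (mathias_le y x) ->
  [/\ [set` s] `<=` [set` t], forall k, k \in t -> k \notin s -> A k & B `<=` A].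
Proof.
move=> Ey Ex H.
have [q1 [q1p [t' H1]]] := H p (le_refl p).
have [q2 [q21 [B' H2]]] := H1 q1 (le_refl _).
have [q3 [q32 [s' H3]]] := H2 q2 (le_refl _).
have [q [q3' [A' [[Ey' Ex'] [ST [TA BA]]]]]] := H3 q3 (le_refl _).
have qp := le_trans q3' (le_trans q32 (le_trans q21 q1p)).
have [Et EB] := pair_inj (feq_trans (feq_sym Ey') (feq_mono qp Ey)).
have [Es EA] := pair_inj (feq_trans (feq_sym Ex') (feq_mono qp Ex)).
have num_mem k S : S k -> fmem (num k) (cset_name S) q.
  by move=> Sk; apply: fmem_cset_intro (feq_refl _ _).
split=> [k sk|k tk sk|k Bk].
- apply: (@fmem_num_cset _ _ q); apply: (fmem_congr Et).
  apply: (ST (num k) q (le_refl q)); apply: (fmem_congr (feq_sym Es)).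
  exact: num_mem.
- apply: (@fmem_num_cset _ _ q); apply: (fmem_congr EA).
  apply: (TA (num k) q (le_refl q) _ q (le_refl q)).
    by apply: (fmem_congr (feq_sym Et)); apply: num_mem.
  move=> r rq H'; move/negP: sk; apply.
  exact: (fmem_num_cset (fmem_congr (feq_mono rq Es) H')).
- apply: (@fmem_num_cset _ _ q); apply: (fmem_congr EA).
  apply: (BA (num k) q (le_refl q)); apply: (fmem_congr (feq_sym EB)).
  exact: num_mem.
Qed.

(* The values of the bijection with a numeral are decided one at a time. *)
Lemma decide_finite s p :
  forces le p (FSub s (omega_name P)) -> forces le p (FFinite s) ->
  exists2 r, le r p & exists t : {fset nat}, feq s (cset_name [set` t]) r.
Proof.
move=> sw fs.
have [p1 [p1p [n [nw Hn]]]] := fs p (le_refl p).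
have /fmem_cset/densely_inh [p2 p21 [N _ EN]] := nw.
have [p3 [p32 [h [_ [h1 h2]]]]] := Hn p2 p21.
have p3p := le_trans p32 (le_trans p21 p1p).
have EN3 := feq_mono p32 EN.
(* Invariant after m values: t collects only numbers forced into s, and every value of h at an index
   below m is forced into t. *)
have key m : m <= N -> densely (fun r => exists2 t : {fset nat},
    forall k, k \in t -> fmem (num k) s r &
    forall i j q, i < m -> le q r -> fmem j s q ->
      fmem (pair_name (num i) j) h q -> fmem j (cset_name [set` t]) q) p3.
  elim: m => [_|m IH mN].
    by apply: denselyW => r rp; exists fset0 => // k; rewrite inE.
  apply: (densely_bind (IH (ltnW mN))) => q qp [t ts tP].
  have mn : fmem (num m) n q.
    apply: (fmem_congr (feq_sym (feq_mono qp EN3))).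
    exact: fmem_num_intro mN (feq_refl _ _).
  move=> q1 q1q.
  have [q2 [q21 [j [js Hj]]]] := h1 (num m) q qp mn q1 q1q.
  have q2q := le_trans q21 q1q.
  have q2p := le_trans q2q (le_trans qp p3p).
  have /fmem_cset/densely_inh [q3 q32 [k _ Ek]] := sw j q2 q2p js.
  exists q3; split; first exact: le_trans q32 q21.
  exists (k |` t)%fset.
    move=> l; rewrite !inE => /orP[/eqP ->|lt].
      by apply: (fmem_congl Ek); apply: fmem_mono js.
    by apply: fmem_mono (ts l lt); apply: le_trans q32 q2q.
  move=> i j' r im rq3 j's ij'.
  move: im; rewrite ltnS leq_eqVlt => /predU1P[Ei|im].
    have [Hj1 _] := Hj j' r (le_trans rq3 q32) j's.
    have E : feq j' j r by apply: Hj1 (le_refl r) _; rewrite -Ei.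
    apply: (@fmem_cset_intro k); first by rewrite /= !inE eqxx.
    by apply: (feq_trans E); apply: feq_mono Ek.
  have H := tP i j' r im (le_trans rq3 (le_trans q32 q2q)) j's ij'.
  apply: (@forces_sub_cset [set` t] [set` (k |` t)%fset] r _ j' r (le_refl r) H).
  by move=> l /= lt; rewrite !inE lt orbT.
have [r rp3 [t ts tP]] := densely_inh (key N (leqnn N)).
have rp := le_trans rp3 p3p.
exists r => //; exists t; apply: feq_ext => q z qr; split=> zs.
- have zs' : forces le q (FMem z s) by [].
  have qp3 := le_trans qr rp3.
  apply: fmem_dense => q0 q0q.
  (* Surjectivity of h gives z an index, decided as some m < N, so z is among the collected
     values. *)
  have [q1 [q10 [i [iN Hi]]]] := h2 z q qp3 zs' q0 q0q.
  have q1q := le_trans q10 q0q.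
  have q1p3 := le_trans q1q qp3.
  have /fmem_num/densely_inh [q2 q21 [m mN Em]] :
    fmem i (num N) q1 by apply: (fmem_congr (feq_mono q1p3 EN3)).
  exists q2; split; first exact: le_trans q21 q10.
  apply: (tP m z q2 mN (le_trans q21 (le_trans q1q qr))).
    exact: fmem_mono (le_trans q21 q1q) zs.
  have [_ Hm] := Hi (num m) q2 q21 (fmem_congl Em (fmem_mono q21 iN)).
  by apply: (Hm q2 (le_refl q2)); apply: feq_sym.
- move/fmem_cset : zs => zt; apply: fmem_dense; apply: (densely_bind zt).
  move=> q1 q1q [k kt Ek]; apply: denselyW => q2 q21.
  apply: (fmem_congl (feq_sym (feq_mono q21 Ek))).
  by apply: fmem_mono (ts k kt); apply: le_trans q21 (le_trans q1q qr).
Qed.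

(** [K B q] is later instantiated with membership of B in the filter q. The stem is decided first,
    then the second coordinate. *)
Lemma decide_mathias_cond (K : set nat -> P -> Prop) U x p :
  forces le p (mathias_cond U x) ->
  (forall A r, fmem A U r ->
     densely (fun q => exists2 B, K B q & feq A (cset_name B) q) r) ->
  exists2 r, le r p & exists (t : {fset nat}) B,
    K B r /\ feq x (pair_name (cset_name [set` t]) (cset_name B)) r.
Proof.
move=> Hx HU; have [p1 [p1p [s H1]]] := Hx p (le_refl p).
have [p2 [p21 [A [Ex [[sw fs] [AU _]]]]]] := H1 p1 (le_refl p1).
have [p3 p32 [t Et]] := decide_finite sw fs.
have /densely_inh [r r3 [B KB EB]] := HU A p3 (fmem_mono p32 AU).
exists r; first exact: le_trans r3 (le_trans p32 (le_trans p21 p1p)).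
exists t, B; split => //; apply: (feq_trans (feq_mono (le_trans r3 p32) Ex)).
by apply: pair_congr EB; apply: feq_mono Et.
Qed.

End ForcingFacts.

(** * Ideals generated by closed families *)

(** The sets Q M form a proper filter base; a cluster point lies in the closure of each of them. *)
Lemma cantor_compact_seq (Q : nat -> set cantor_space) :
  (forall M, closed (Q M)) -> (forall M, Q M !=set0) ->
  (forall M N, M <= N -> Q N `<=` Q M) -> exists x, forall M, Q M x.
Proof.
move=> Qc Q0 Qd.
have FF : Filter (filter_from setT Q).
  apply: filter_from_filter; first by exists 0.
  move=> i j _ _; exists (maxn i j) => // x Qx.
  by split; apply: Qd Qx; [apply: leq_maxl|apply: leq_maxr].
have PF : ProperFilter (filter_from setT Q) by apply: filter_from_proper.
have [x [_ clx]] := cantor_space_compact PF filterT.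
exists x => M; rewrite (iffLR (closure_id _) (Qc M)).
by move: clx; rewrite clusterE; apply; exists M.
Qed.

Lemma cantor_local_closed (M : nat) (Q : set cantor_space) :
  (forall x y : cantor_space, (forall i, i < M -> x i = y i) -> Q x -> Q y) -> closed Q.
Proof.
move=> loc x clx.
suff /clx [y [Qy yx]] : nbhs x [set y : cantor_space | forall i, i < M -> y i = x i].
  exact: loc Qy.
elim: M {loc} => [|M IH]; first by apply: filterS filterT.
have nM : nbhs x [set y : cantor_space | y M = x M].
  by apply: (@proj_continuous nat (fun=> bool) M x [set b | b = x M]).
apply: filterS (filterI IH nM) => y [yM yx] i.
by rewrite ltnS leq_eqVlt => /predU1P[->//|]; apply: yM.
Qed.

(* For downward closed Z, the second clause is topological closedness. *)
Definition finitary (Z : set (set nat)) :=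
  (forall S T, S `<=` T -> Z T -> Z S) /\
  (forall T, (forall M, Z (T `&` `I_M)) -> Z T).

(* T is covered by 2^k members of Z. *)
Fixpoint cover (Z : set (set nat)) k (T : set nat) : Prop :=
  if k is k'.+1 then
    exists T0 T1, [/\ T `<=` T0 `|` T1, cover Z k' T0 & cover Z k' T1]
  else Z T.

Lemma cover_sub Z k S T : (forall S T, S `<=` T -> Z T -> Z S) ->
  S `<=` T -> cover Z k T -> cover Z k S.
Proof.
move=> Zd ST; case: k => [|k] /=; first exact: Zd.
by move=> [T0 [T1 [TT c0 c1]]]; exists T0, T1; split => // n /ST /TT.
Qed.

Lemma cover_leq Z k l T : k <= l -> cover Z k T -> cover Z l T.
Proof.
move=> /subnK <-; elim: (l - k) => [//|m IH] c.
by rewrite addSn; exists T, T; split; [move=> n; left|exact: IH..].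
Qed.

Lemma sub_cover (Z Z' : set (set nat)) k T :
  Z `<=` Z' -> cover Z k T -> cover Z' k T.
Proof.
move=> ZZ; elim: k T => [T /ZZ //|k IH T [T0 [T1 [TT c0 c1]]]].
by exists T0, T1; split => //; apply: IH.
Qed.

Lemma coverU Z k l S T : cover Z k S -> cover Z l T ->
  cover Z (maxn k l).+1 (S `|` T).
Proof.
move=> cS cT; exists S, T; split => //.
  by apply: cover_leq cS; apply: leq_maxl.
by apply: cover_leq cT; apply: leq_maxr.
Qed.

Lemma cover_bounded (Z : set (set nat)) M :
  Z set0 -> (forall n, Z [set n]) -> exists k, cover Z k `I_M.
Proof.
move=> Z0 Z1; elim: M => [|M [k ck]]; first by exists 0; rewrite II0.
by exists (maxn k 0).+1; rewrite IIS; apply: coverU.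
Qed.

Lemma cover_filter (F : set_system nat) Z k T : Filter F ->
  (forall S, Z S -> F (~` S)) -> cover Z k T -> F (~` T).
Proof.
move=> FF ZF; elim: k T => [T /ZF //|k IH T [T0 [T1 [TT /IH F0 /IH F1]]]].
by apply: filterS (filterI F0 F1) => n [n0 n1] /TT [].
Qed.

(** By compactness, splittings that work for every cut of T below M converge to one that works for
    T. *)
Lemma finitary_cover Z k : finitary Z -> finitary (cover Z k).
Proof.
move=> Zf; split=> [S T|]; first by apply: cover_sub Zf.1.
elim: k => [|k IH T cT]; first exact: Zf.2.
have cd S S' := @cover_sub Z k S S' Zf.1.
have IM M N : M <= N -> `I_M `<=` `I_N by move=> MN n /= /leq_trans; apply.
(* The points x such that x and its complement split T correctly below M; these sets decrease with
   M. *)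
pose Q M := [set x : cantor_space | cover Z k (T `&` [set n | x n] `&` `I_M) /\
   cover Z k (T `&` ~` [set n | x n] `&` `I_M)].
have [||| x Qx] := @cantor_compact_seq Q.
- move=> M; apply: (@cantor_local_closed M) => x y xy [H0 H1]; split.
    by apply: cd H0 => n [[Tn yn] nM]; split => //; split => //=; rewrite xy.
  by apply: cd H1 => n [[Tn yn] nM]; split => //; split => //=; rewrite xy.
- move=> M; have [T0 [T1 [TT c0 c1]]] := cT M.
  (* Splitting along T0 suffices: what remains of the cut lies in T1. *)
  exists (fun n => `[< T0 n >]); split.
    by apply: cd c0 => n [[_ /asboolP]].
  apply: cd c1 => n [[Tn /= T0n] nM].
  by have [/asboolP/T0n|] := TT n (conj Tn nM).
- move=> M N MN x [H0 H1].
  by split; [apply: cd H0|apply: cd H1]; apply: setIS; apply: IM.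
exists (T `&` [set n | x n]), (T `&` ~` [set n | x n]); split.
- by rewrite -setIUr setUv setIT.
- by apply: IH => M; have [] := Qx M.
- by apply: IH => M; have [] := Qx M.
Qed.

(** An intersection over M of sets that depend only on the first M coordinates. *)
Lemma closed_finitary Z : finitary Z ->
  closed [set x : cantor_space | Z (~` [set n | x n])].
Proof.
move=> [Zd Zf].
have -> : [set x : cantor_space | Z (~` [set n | x n])] =
    \bigcap_M [set x : cantor_space | Z (~` [set n | x n] `&` `I_M)].
  apply/seteqP; split=> [x Zx M _|x Zx]; first by apply: Zd Zx; apply: subIsetl.
  by apply: Zf => M; apply: Zx.
apply: closed_bigI => M _; apply: (@cantor_local_closed M) => x y xy.
by apply: Zd => n [yn nM]; split => //=; rewrite xy.
Qed.

(** The sets disjoint from a member of C. If C is contained in a filter, they lie in the dual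
    ideal. *)
Definition avoid (C : set cantor_space) : set (set nat) :=
  [set T | exists2 x, C x & T `<=` ~` [set n | x n]].

Lemma finitary_avoid C : closed C -> finitary (avoid C).
Proof.
move=> Cc; split=> [S T ST [x Cx Tx]|T H].
  by exists x => //; apply: subset_trans Tx.
pose Q M := C `&` [set x : cantor_space | T `&` `I_M `<=` ~` [set n | x n]].
have [||| x Qx] := @cantor_compact_seq Q.
- move=> M; apply: closedI => //; apply: (@cantor_local_closed M) => x y xy Tx n.
  by move=> Tn /= yn; apply: (Tx n Tn); rewrite /= xy //; case: Tn.
- by move=> M; have [x Cx Tx] := H M; exists x.
- move=> M N MN x [Cx Tx]; split => // n [Tn nM]; apply: Tx; split => //.
  exact: leq_trans nM MN.
by exists x => [|n Tn]; [case: (Qx 0)|case: (Qx n.+1) => _; apply; split => /=].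
Qed.

(** Singletons together with the empty set, so that the family is downward closed. *)
Definition subsingleton : set (set nat) :=
  [set T | forall a b, T a -> T b -> a = b].

Lemma finitary_subsingleton : finitary subsingleton.
Proof.
split=> [S T ST H a b /ST Ta /ST Tb|T H a b Ta Tb]; first exact: H.
apply: (H (maxn a b).+1); split => //=; rewrite ltnS ?leq_maxl ?leq_maxr //.
Qed.

(** If the cuts of T at M and M' leave Z and Z' respectively, the cut at the maximum leaves both. *)
Lemma finitaryU Z Z' : finitary Z -> finitary Z' -> finitary (Z `|` Z').
Proof.
move=> [Zd Zf] [Zd' Zf']; split=> [S T ST [/(Zd _ _ ST)|/(Zd' _ _ ST)]|T H].
- by left.
- by right.
apply: contrapT => /not_orP [nZ nZ'].
have /existsNP [M nM] : ~ forall M, Z (T `&` `I_M) by move=> /Zf.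
have /existsNP [M' nM'] : ~ forall M, Z' (T `&` `I_M) by move=> /Zf'.
have [H'|H'] := H (maxn M M').
  by apply: nM; apply: Zd H'; apply: setIS => n /= Mn; rewrite leq_max Mn.
by apply: nM'; apply: Zd' H'; apply: setIS => n /= Mn; rewrite leq_max Mn orbT.
Qed.

(** * The filter of a 0-condition *)

Lemma fset_bounded (u : {fset nat}) : exists M, [set` u] `<=` `I_M.
Proof.
exists (\max_(i <- u) i).+1 => n /= nu; rewrite ltnS.
by rewrite (big_rem n) //= leq_maxl.
Qed.

Lemma norm_subsingleton (x : set nat) nor (u : {fset nat}) :
  is_norm x nor -> [set` u] `<=` x -> subsingleton [set` u] -> nor u = 0.
Proof.
move=> [n1 _ _] ux us; apply/eqP; rewrite -leqn0 leqNgt; apply/negP => /(n1 _ ux).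
rewrite ltnNge => /negP; apply; have [->|[a au]] := fset_0Vmem u.
  by rewrite cardfs0.
rewrite -(cardfs1 a) fsubset_leq_card //; apply/fsubsetP => b bu.
by rewrite inE; apply/eqP/us.
Qed.

Section Condition.
Variable p : cond0.

Lemma cnor_atP n : is_norm [set` cset_at p n] (cnor_at p n).
Proof. exact: cnor_is_norm. Qed.

Lemma cset_at_neq0 n : exists k, k \in cset_at p n.
Proof.
have [e|[k kn]] := fset_0Vmem (cset_at p n); last by exists k.
by have := cset_neq0 (creat p n); rewrite -/(cset_at p n) e eqxx.
Qed.

Lemma cset_at_lt m n i j :
  m < n -> i \in cset_at p m -> j \in cset_at p n -> i < j.
Proof.
elim: n j => // n IH j; rewrite ltnS leq_eqVlt => /predU1P[<-|mn] im jn.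
  exact: (creat_lt p m).1.
have [k kn] := cset_at_neq0 n.
exact: ltn_trans (IH k mn im kn) ((creat_lt p n).1 k j kn jn).
Qed.

Lemma leq_cset_at n k : k \in cset_at p n -> n <= k.
Proof.
elim: n k => // n IH k kn; have [j jn] := cset_at_neq0 n.
by apply: leq_ltn_trans (IH j jn) _; apply: cset_at_lt (ltnSn n) jn kn.
Qed.

Lemma ltn_cnor_at n : n < cnor_at p n (cset_at p n).
Proof.
elim: n => [|n IH]; first exact: cnor_gt0.
by apply: leq_ltn_trans IH _; apply: (creat_lt p n).2.
Qed.

Lemma cset_at_gap j :
  exists b, forall m k, m <= j -> k \in cset_at p m -> k < b.
Proof.
have [b bj] := cset_at_neq0 j.+1.
by exists b => m k mj km; apply: cset_at_lt km bj.
Qed.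

(** Ranging over finite u avoids forming the intersection of T with a block as a finite set; by
    monotonicity of norms the meaning is the same. *)
Definition null : set (set nat) := [set T | forall n (u : {fset nat}),
  [set` u] `<=` [set` cset_at p n] -> [set` u] `<=` T -> cnor_at p n u = 0].

Lemma null_sub S T : S `<=` T -> null T -> null S.
Proof. by move=> ST nT n u un uS; apply: nT => //; apply: subset_trans ST. Qed.

Lemma finitary_null : finitary null.
Proof.
split; first exact: null_sub.
move=> T H n u un uT; have [M uM] := fset_bounded u.
by apply: (H M) => // k ku; split; [apply: uT|apply: uM].
Qed.

Lemma null_subsingleton T : subsingleton T -> null T.
Proof.
move=> Ts n u un uT; apply: (norm_subsingleton (cnor_atP n)) => // a b au bu.
by apply: Ts; apply: uT.
Qed.

Lemma cover_null_norm k T n (u : {fset nat}) : cover null k T ->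
  [set` u] `<=` [set` cset_at p n] -> [set` u] `<=` T -> cnor_at p n u <= k.
Proof.
elim: k T u => [|k IH] T u; first by move=> /(_ n u) H un uT; rewrite H.
move=> [T0 [T1 [TT c0 c1]]] un uT; rewrite leqNgt; apply/negP => nu.
pose s S := [fset k in u | `[< S k >]]%fset.
have sE S j : (j \in s S) = (j \in u) && `[< S j >] by rewrite !inE.
have us : u = (s T0 `|` s T1)%fset.
  apply/fsetP => j; rewrite in_fsetU !sE -andb_orr; case ju: (j \in u) => //=.
  by apply/esym/orP; have [/asboolP|/asboolP] := TT j (uT j ju); [left|right].
have sn S j : j \in s S -> j \in cset_at p n.
  by rewrite sE => /andP[/un].
have sT S j : j \in s S -> S j by rewrite sE => /andP[_ /asboolP].
(* A norm of at least k+2 would leave one half with norm at least k+1, against the induction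
   hypothesis. *)
have [_ _ /(_ _ u (s T0) (s T1) un (ltn0Sn _) nu us)] := cnor_atP n.
by case; rewrite ltnNge => /negP; apply;
  [apply: (IH T0)|apply: (IH T1)] => // j; [apply: sn|apply: sT|apply: sn|apply: sT].
Qed.

Definition cond_filter : set_system nat :=
  [set A | exists k, cover null k (~` A)].

(** The complement of [cond0_int p] meets no block, so it is null. *)
Lemma cond_filter_int : cond_filter (cond0_int p).
Proof.
exists 0 => /= n u un uT; apply: (norm_subsingleton (cnor_atP n)) => // a b au.
by have /= [] := uT a au; exists n; apply: un.
Qed.

Lemma null0 : null set0.
Proof. by apply: null_subsingleton. Qed.

Lemma null1 n : null [set n].
Proof. by apply: null_subsingleton => a b -> ->. Qed.

Lemma cond_filterP :
  [/\ ProperFilter cond_filter, \oo `<=` cond_filter & Fsigma_system cond_filter].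
Proof.
have FF : Filter cond_filter.
  split; first by exists 0; rewrite setCT; apply: null0.
    move=> A B [k ck] [l cl]; exists (maxn k l).+1.
    by rewrite setCI; apply: coverU.
  move=> A B AB [k ck]; exists k.
  by apply: cover_sub ck; [apply: null_sub|apply: subsetC].
split.
- split=> // -[k]; rewrite setC0 => ck.
  (* If 2^k null sets covered everything, block k would have norm at most k, but the norm of block k
     exceeds k. *)
  have : cnor_at p k (cset_at p k) <= k by apply: (cover_null_norm ck).
  by rewrite leqNgt ltn_cnor_at.
- move=> A [M _ MA]; have [k ck] := cover_bounded M null0 null1.
  exists k; apply: cover_sub ck; first exact: null_sub.
  by move=> n; apply: contra_notP => /= /negP; rewrite -leqNgt; apply: MA.
(* The k-th closed piece: sets whose complement is covered by 2^k null sets. *)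
- exists (fun k => [set x : cantor_space | cover null k (~` [set n | x n])]).
    by move=> k; apply: closed_finitary; apply: finitary_cover; apply: finitary_null.
  by apply/seteqP; split=> x [k]; [exists k|exists k].
Qed.

Definition cond_Fsigma : Fsigma_filter := exist _ cond_filter cond_filterP.

(** The index n_0 of clause (8). It exists because elements of block m are at least m, so late
    blocks miss the finite t. *)
Lemma first_free (t : {fset nat}) : exists n0,
  (forall m, n0 <= m -> (cset_at p m `&` t = fset0)%fset) /\
  forall n1, (forall m, n1 <= m -> (cset_at p m `&` t = fset0)%fset) -> n0 <= n1.
Proof.
pose Q n := `[< forall m, n <= m -> (cset_at p m `&` t = fset0)%fset >].
have exQ : exists n, Q n.
  have [M tM] := fset_bounded t; exists M; apply/asboolP => m Mm.
  apply/fsetP => k; rewrite !inE; apply/negP => /andP[/leq_cset_at mk /tM /=].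
  by rewrite ltnNge (leq_trans Mm mk).
by case: (ex_minnP exQ) => n /asboolP Qn Qmin; exists n; split => // n1 /asboolP /Qmin.
Qed.

End Condition.

Lemma cond_filter_le p q : cond0_le q p -> cond_filter p `<=` cond_filter q.
Proof.
move=> [_ [i [_ _ iP]] H9] A [k ck]; exists k; apply: sub_cover ck => T nT.
move=> n u un uT; apply/eqP; rewrite -leqn0 leqNgt; apply/negP => nu.
have [|m] := H9 n u _ nu; first by apply/fsubsetP.
rewrite nT // => j /=; rewrite inE => /andP[] // /uT //.
Qed.

(** Replaces clauses (8) and (9) by what a recursive construction of r can secure: p-null sets get
    norm 0, and each block of r starts beyond prescribed blocks of p. *)
Lemma cond0_leI (p r : cond0) (n0 : nat) :
  (stem p `<=` stem r)%fset ->
  (forall k, k \in stem r -> k \notin stem p -> cond0_int p k) ->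
  cond0_int r `<=` cond0_int p ->
  (forall n (u : {fset nat}), [set` u] `<=` [set` cset_at r n] ->
     null p [set` u] -> cnor_at r n u = 0) ->
  (forall m, n0 <= m -> (cset_at p m `&` stem r = fset0)%fset) ->
  (forall n1, (forall m, n1 <= m -> (cset_at p m `&` stem r = fset0)%fset) ->
     n0 <= n1) ->
  (forall m k k', m < n0 -> k \in cset_at p m -> k' \in cset_at r 0 -> k < k') ->
  (forall n j m k k', j \in cset_at r n -> m <= j -> k \in cset_at p m ->
     k' \in cset_at r n.+1 -> k < k') ->
  cond0_le r p.
Proof.
move=> st sint rint nullr n0P n0min gap0 gap.
have /choice [b bP] : forall n, exists b, b \in cset_at r n /\
    forall k, k \in cset_at r n -> k <= b.
  move=> n; have [k kn] := cset_at_neq0 r n.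
  have exb : exists b, b \in cset_at r n by exists k.
  have [M rM] := fset_bounded (cset_at r n).
  have [|b bn bmax] := @ex_maxnP (fun b => b \in cset_at r n) M exb.
    by move=> j /rM /ltnW.
  by exists b.
(* Here b n' is the maximum of block n' of r. An element k of that block lies in a block of p of
   index at most k, hence below i n'.+1, and the gap hypothesis pushes the next block of r past all
   those indices. *)
pose i n := if n is n'.+1 then (b n').+1 else n0.
have above n m k : k \in cset_at r n -> k \in cset_at p m -> i n <= m.
  case: n => [|n] kr kp /=; rewrite leqNgt; apply/negP => mi.
    by have := gap0 m k k mi kp kr; rewrite ltnn.
  by have := gap n (b n) m k k (bP n).1 mi kp kr; rewrite ltnn.
have below n m k : k \in cset_at r n -> k \in cset_at p m -> m < i n.+1.
  move=> kr kp; rewrite ltnS; apply: leq_trans ((bP n).2 k kr).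
  exact: leq_cset_at kp.
have pblock n k : k \in cset_at r n -> exists m, k \in cset_at p m.
  by move=> kr; apply: rint; exists n.
split; first by [].
  exists i; split => // [n|n k kr].
    have [k kr] := cset_at_neq0 r n; have [m kp] := pblock n k kr.
    exact: leq_ltn_trans (above n m k kr kp) (below n m k kr kp).
  have [m kp] := pblock n k kr; exists m; split => //.
  by rewrite (above n m k) // (below n m k).
(* Clause (9): if all traces of t on blocks of p had norm 0, t would be p-null by monotonicity, so
   of norm 0 in r. *)
move=> n t tn nt; apply: contrapT => /forallNP H.
move: nt; rewrite nullr //; first by move=> j; apply: (fsubsetP tn).
move=> m u um ut; have [_ mono _] := cnor_atP p m.
have /negP := H m; rewrite -leqNgt leqn0 => /eqP nor0.
apply/eqP; rewrite -leqn0 -nor0; apply: mono.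
  by move=> j; rewrite /= inE => /andP[].
by apply/fsubsetP => j ju; rewrite inE; apply/andP; split; [apply: ut|apply: um].
Qed.

(** * Constructing 0-conditions *)

(** The norm is the logarithmic covering number by Z: the least k such that 2^k members of Z cover
    the set. *)
Lemma creature_exists (F : set_system nat) Z B N L : ProperFilter F -> \oo `<=` F ->
  finitary Z -> subsingleton `<=` Z -> (forall S, Z S -> F (~` S)) -> F B ->
  exists c : creature, [/\ forall k, k \in cset c -> N <= k /\ B k,
    L < cnor c (cset c) &
    forall u : {fset nat}, Z [set` u] -> cnor c u = 0].
Proof.
move=> FF FO Zf Zs ZF FB.
have Z0 : Z set0 by apply: Zs.
have Z1 n : Z [set n] by apply: Zs => a b -> ->.
have /choice [nor norP] : forall u : {fset nat}, exists k, cover Z k [set` u] /\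
    forall l, cover Z l [set` u] -> k <= l.
  move=> u; have exk : exists k, `[< cover Z k [set` u] >].
    have [M uM] := fset_bounded u; have [k ck] := cover_bounded M Z0 Z1.
    by exists k; apply/asboolP; apply: cover_sub ck => //; case: Zf.
  case: (ex_minnP exk) => k /asboolP ck kmin.
  by exists k; split => // l /asboolP /kmin.
have nor_gt0 u : 0 < nor u -> ~ Z [set` u].
  by move=> nu Zu; have := (norP u).2 0 Zu; rewrite leqNgt nu.
pose T := B `&` [set n | N <= n].
(* If every cut of T were covered by 2^L members of Z, so would T be; then F would contain T and its
   complement. *)
have /existsNP [M nM] : ~ forall M, cover Z L (T `&` `I_M).
  move=> /(finitary_cover L Zf).2 /(cover_filter _ ZF) FT.
  have FT' : F T by apply: filterI => //; apply: FO; exists N.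
  by have [x []] := filter_ex (filterI FT FT').
pose s := fset_set (T `&` `I_M).
have sE : [set` s] = T `&` `I_M by rewrite fset_setK //; apply: finite_setIr; apply: finite_II.
have snor : L < nor s.
  rewrite ltnNge; apply/negP => sL; apply: nM; rewrite -sE.
  by apply: cover_leq sL _; apply: (norP s).1.
have nor_norm : is_norm [set` s] nor.
  split=> [u us nu|u v vs uv|n u u0 u1 us n0 nu uE].
  - rewrite ltnNge; apply/negP => u1; apply: (nor_gt0 u nu); apply: Zs => a b au bu.
    move: u1; rewrite leq_eqVlt => /orP[/cardfs1P [c uc]|].
      by move: au bu; rewrite /= uc !inE => /eqP -> /eqP ->.
    by rewrite ltnS leqn0 cardfs_eq0 => /eqP u0; move: au; rewrite /= u0.
  - apply: (norP u).2; apply: cover_sub (norP v).1; first by case: Zf.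
    by move=> j; apply: (fsubsetP uv).
  (* For n = 1 the bound is 0. Otherwise, covering both halves by 2^n sets, with the new n, covers
     the union by 2^(n+1). *)
  - case: n n0 nu => // -[|n] _ nu; first by left.
    rewrite /=; apply/orP; rewrite -[_ || _]negbK negb_or -!ltnNge !ltnS.
    apply/negP => /andP[h0 h1]; move: nu; rewrite ltnNge => /negP; apply.
    apply: (norP u).2; rewrite uE; exists [set` u0], [set` u1]; split.
    + by move=> j /=; rewrite inE => /orP.
    + exact: cover_leq h0 (norP u0).1.
    + exact: cover_leq h1 (norP u1).1.
have s0 : s != fset0.
  apply/eqP => s0; move: (leq_trans (ltn0Sn _) snor) => /nor_gt0; apply.
  by apply: Zs => a b; rewrite /= s0.
exists (Creature s0 nor_norm (leq_trans (ltn0Sn _) snor)); split => //=.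
- move=> k ks; have : [set` s] k by [].
  by rewrite sE => -[[]].
- by move=> u Zu; apply/eqP; rewrite -leqn0; apply: (norP u).2.
Qed.

(** K lists sets to be given norm 0, while [N0] and [g] prescribe where the first block starts and
    how far later blocks must jump. *)
Lemma cond0_refine (F : set_system nat) (K : set (set nat)) (B : set nat)
    (t : {fset nat}) N0 (g : nat -> nat) :
  ProperFilter F -> \oo `<=` F -> Fsigma_system F -> F B ->
  finitary K -> (forall S, K S -> F (~` S)) ->
  exists r : cond0, [/\ stem r = t, cond0_int r `<=` B, F `<=` cond_filter r,
    (forall n (u : {fset nat}), K [set` u] -> cnor_at r n u = 0) &
    (forall k, k \in cset_at r 0 -> N0 <= k) /\
    (forall n j k, j \in cset_at r n -> k \in cset_at r n.+1 -> g j <= k)].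
Proof.
move=> FF FO [C Cc FC] FB Kf KF.
have FE A : F A -> exists k, avoid (C k) (~` A).
  move=> FA; have : [set x : cantor_space | F [set n | x n]] (fun n => `[< A n >]).
    by apply: filterS FA => n An; apply/asboolP.
  rewrite FC => -[k _ Cx]; exists k; exists (fun n => `[< A n >]) => //.
  by move=> n nA /asboolP.
have CF k S : avoid (C k) S -> F (~` S).
  move=> [x Cx Sx]; have : (\bigcup_i C i) x by exists k.
  by rewrite -FC; apply: filterS => n xn Sn; apply: Sx Sn xn.
(* Stage n handles the closed pieces C_k with k < n, so a set avoiding a member of C_k has norm 0 in
   all blocks after k. *)
pose Z := fix Z n := if n is n'.+1 then Z n' `|` avoid (C n') else subsingleton `|` K.
have Zf n : finitary (Z n).
  elim: n => [|n IH] /=; apply: finitaryU => //; first exact: finitary_subsingleton.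
  exact: finitary_avoid.
have Z0 n : subsingleton `|` K `<=` Z n by elim: n => // n IH S /IH; left.
have ZF n S : Z n S -> F (~` S).
  elim: n => [[Ss|/KF //]|n IH [/IH //|/CF //]].
  have [[a Sa]|nS] := pselect (exists a, S a); last first.
    by apply: filterS filterT => a _ Sa; apply: nS; exists a.
  apply: FO; exists a.+1 => // b /= ab Sb.
  by move: ab; rewrite (Ss a b Sa Sb) ltnn.
have ZC k n : k < n -> avoid (C k) `<=` Z n.
  elim: n => // n IH; rewrite ltnS leq_eqVlt => /predU1P[->|kn] S aS; first by right.
  by left; apply: IH.
(* The triple holds the stage n, a lower bound N for the elements and a strict lower bound L for the
   norm. *)
have /choice [mk mkP] : forall a : nat * nat * nat, exists c : creature,
    [/\ forall k, k \in cset c -> a.1.2 <= k /\ B k, a.2 < cnor c (cset c) &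
    forall u : {fset nat}, Z a.1.1 [set` u] -> cnor c u = 0].
  move=> [[n N] L]; apply: creature_exists (FF) FO (Zf n) _ (@ZF n) FB.
  by move=> S Ss; apply: Z0; left.
have [Mt tM] := fset_bounded t.
(* Above every element j of the block and at least [g j]: this secures both the order of creatures
   and the jumps. *)
pose bnd (c : creature) := \max_(j <- cset c) maxn j.+1 (g j).
have bndP c j : j \in cset c -> maxn j.+1 (g j) <= bnd c.
  by move=> jc; rewrite /bnd (big_rem j) //= leq_maxl.
pose c := fix c n := if n is n'.+1 then mk (n'.+1, bnd (c n'), cnor (c n') (cset (c n')))
  else mk (0, maxn N0 Mt, 0).
have cE n : exists N L, c n = mk (n, N, L).
  by case: n => [|n]; [exists (maxn N0 Mt), 0|
    exists (bnd (c n)), (cnor (c n) (cset (c n)))].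
have cB n k : k \in cset (c n) -> B k.
  by have [N [L ->]] := cE n => kc; have [/(_ k kc) []] := mkP (n, N, L).
have cZ n (u : {fset nat}) : Z n [set` u] -> cnor (c n) u = 0.
  by have [N [L ->]] := cE n => Zu; have [_ _ /(_ u Zu)] := mkP (n, N, L).
have cS n k : k \in cset (c n.+1) -> bnd (c n) <= k.
  by move=> kc; have [/(_ k kc) []] := mkP (n.+1, bnd (c n), cnor (c n) (cset (c n))).
have c0 k : k \in cset (c 0) -> maxn N0 Mt <= k.
  by move=> kc; have [/(_ k kc) []] := mkP (0, maxn N0 Mt, 0).
have clt n : creature_lt (c n) (c n.+1).
  split=> [i j ic jc|]; last by have [] := mkP (n.+1, bnd (c n), cnor (c n) (cset (c n))).
  apply: leq_trans (cS n j jc); apply: leq_trans (bndP _ _ ic).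
  exact: leq_maxl.
have tlt i j : i \in t -> j \in cset (c 0) -> i < j.
  move=> /tM /= iM /c0; rewrite geq_max => /andP[_]; exact: leq_trans.
exists (Cond0 clt tlt); split => //.
- by move=> k [n]; apply: cB.
- move=> A /FE [k aA].
  (* The blocks up to k lie below M. The complement of A splits into a null part beyond M and a
     finite part covered by singletons. *)
  have [M kM] : exists M, forall n j, n <= k -> j \in cset (c n) -> j < M.
    have [b bP] := cset_at_gap (Cond0 clt tlt) k.
    by exists b => n j; apply: bP.
  have [l cl] := cover_bounded M (@null0 (Cond0 clt tlt)) (@null1 (Cond0 clt tlt)).
  have cN : null (Cond0 clt tlt) (~` A `&` ~` `I_M).
    move=> n u un uA; have [nk|kn] := leqP n k.
      apply: (norm_subsingleton (cnor_atP _ n)) => // a b /[dup] /uA [_ aM] /un ac.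
      by case: aM; apply: kM ac.
    apply: cZ; apply: (ZC k n kn); case: aA => x Cx Ax; exists x => //.
    by move=> j /uA [/Ax].
  exists (maxn 0 l).+1; apply: (cover_sub _ _ (@coverU _ 0 l _ _ cN cl)).
    exact: null_sub.
  by move=> j Aj; have [jM|jM] := pselect (`I_M j); [right|left].
- by move=> n u Ku; apply: cZ; apply: Z0; right.
- split=> [k /c0|n j k jc /cS]; first by rewrite geq_max => /andP[].
  by apply: leq_trans; apply: leq_trans (bndP _ _ jc); apply: leq_maxr.
Qed.
(** * The embedding *)

Lemma Fsigma_filter_le_refl F : Fsigma_filter_le F F.
Proof. exact: subset_refl. Qed.

Lemma Fsigma_filter_le_trans (G F H : Fsigma_filter) :
  Fsigma_filter_le F G -> Fsigma_filter_le G H -> Fsigma_filter_le F H.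
Proof. by move=> FG GH; apply: subset_trans GH FG. Qed.

Local Notation le := Fsigma_filter_le.
Local Notation le_refl := Fsigma_filter_le_refl.
Local Notation le_trans := Fsigma_filter_le_trans.

(** Members of the generic filter are densely decided to be ground-model sets belonging to the
    current condition. *)
Lemma fmem_generic x (F : Fsigma_filter) :
  forces_mem le x generic_name F <->
  densely le (fun G => exists2 A, sval G A & forces_eq le x (cset_name _ A) G) F.
Proof.
split=> H; apply: (densely_bind le_refl le_trans H) => G _.
- move=> [[[G' A] G'A] [GG' E]]; apply: (denselyW le_refl) => H' H'G.
  exists A; first exact/H'G/GG'.
  exact: (feq_mono le_trans H'G E).
- move=> [A GA E] H' H'G; exists H'; split; first exact: le_refl.
  exists (exist _ (G, A) GA); split => //.
  exact: (feq_mono le_trans H'G E).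
Qed.

Lemma stem_lt_int (p : cond0) i j : i \in stem p -> cond0_int p j -> i < j.
Proof.
move=> ip [[|n] jn]; first exact: stem_lt jn.
have [k k0] := cset_at_neq0 p 0.
exact: ltn_trans (stem_lt ip k0) (cset_at_lt (ltn0Sn n) k0 jn).
Qed.

Definition embed_name (p : cond0) : name Fsigma_filter :=
  pair_name (cset_name _ [set` stem p]) (cset_name _ (cond0_int p)).

Lemma embed_nameP p :
  forces le (cond_Fsigma p) (mathias_cond generic_name (embed_name p)).
Proof.
apply: (forces_mathias_cond le_refl le_trans); first exact: stem_lt_int.
apply/fmem_generic/(denselyW le_refl) => G Gp; exists (cond0_int p).
  exact/Gp/cond_filter_int.
exact: feq_refl le_refl _ _.
Qed.

Definition embed (p : cond0) : two_step le (mathias_cond generic_name) :=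
  exist _ (cond_Fsigma p, embed_name p) (@embed_nameP p).

Lemma cond0_le_int p q : cond0_le q p -> cond0_int q `<=` cond0_int p.
Proof.
move=> [_ [i [_ _ iP]] _] k [n kn].
by have [m [_ km]] := iP n k kn; exists m.
Qed.

Lemma embed_le p q : cond0_le q p ->
  two_step_le (@mathias_le Fsigma_filter) (embed q) (embed p).
Proof.
move=> qp; split; first exact: cond_filter_le.
have [[st sint] _ _] := qp.
apply: (forces_mathias_le le_refl le_trans (feq_refl le_refl _ _)
  (feq_refl le_refl _ _)).
- by move=> k; apply: (fsubsetP st).
- exact: sint.
- exact: cond0_le_int.
Qed.

(** * Density of the range and preservation of incompatibility *)

Lemma decide_condition (u : two_step le (mathias_cond generic_name)) :
  exists2 F, le F (sval u).1 & exists (t : {fset nat}) B, sval F B /\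
    forces_eq le (sval u).2 (pair_name (cset_name _ [set` t]) (cset_name _ B)) F.
Proof.
case: u => -[F x] Fx.
apply: (@decide_mathias_cond _ le le_refl le_trans (fun B G => sval G B)
  generic_name x F Fx).
by move=> A G /fmem_generic.
Qed.

Lemma embed_dense (u : two_step le (mathias_cond generic_name)) :
  exists p, two_step_le (@mathias_le Fsigma_filter) (embed p) u.
Proof.
have [F Fu [t [B [FB Eu]]]] := decide_condition u.
have [FF FO FS] := svalP F.
have f0 : finitary set0 by split=> // T /(_ 0).
(* Density prescribes neither null sets nor a starting point nor jumps: hence [set0], 0 and [id]. *)
have [//|p [pt pB Fp _ _]] := @cond0_refine _ set0 B t 0 id FF FO FS FB f0.
exists p; split; first exact: subset_trans Fu Fp.
have Ep := feq_mono le_trans (Fp : le (cond_Fsigma p) F) Eu.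
apply: (@forces_mathias_le _ le le_refl le_trans (sval u).2 (embed_name p)
  t (stem p) B (cond0_int p) (cond_Fsigma p) (feq_refl le_refl _ _) Ep) => //.
- by rewrite pt.
- by rewrite pt => k ->.
Qed.

(** Sets null for p or for q lie in the ideal dual to F, so [cond0_refine] yields r with stem t that
    gives both kinds norm 0. *)
Lemma amalgamate (F : Fsigma_filter) (t : {fset nat}) p q :
  sval (cond_Fsigma p) `<=` sval F -> sval (cond_Fsigma q) `<=` sval F ->
  (stem p `<=` t)%fset -> (forall k, k \in t -> k \notin stem p -> cond0_int p k) ->
  (stem q `<=` t)%fset -> (forall k, k \in t -> k \notin stem q -> cond0_int q k) ->
  compatible cond0_le p q.
Proof.
move=> pF qF stp intp stq intq.
have [FF FO FS] := svalP F.
have FB : sval F (cond0_int p `&` cond0_int q).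
  by apply: filterI; [apply/pF/cond_filter_int|apply/qF/cond_filter_int].
have nullF p' S : sval (cond_Fsigma p') `<=` sval F -> null p' S -> sval F (~` S).
  by move=> p'F nS; apply: p'F; exists 0; rewrite setCK.
have Kf := finitaryU (finitary_null p) (finitary_null q).
have [n0 [n0P n0min]] := first_free p t.
have [n1 [n1P n1min]] := first_free q t.
have /choice [gp gpP] := cset_at_gap p.
have /choice [gq gqP] := cset_at_gap q.
(* The start and the jumps are maxima of the gap bounds of p and q, so [cond0_leI] applies to
   each. *)
have [S [nS|nS]|r [rt rB _ rK [r0 rS]]] := @cond0_refine _ (null p `|` null q) _ t
  (maxn (gp n0) (gq n1)) (fun j => maxn (gp j) (gq j)) FF FO FS FB Kf.
- exact: nullF nS.
- exact: nullF nS.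
exists r; split.
- apply: (@cond0_leI p r n0); rewrite ?rt //.
  + by apply: subset_trans rB _; apply: subIsetl.
  + by move=> n u _ nu; apply: rK; left.
  + move=> m k k' mn km /r0; apply: leq_trans; rewrite leq_max.
    by rewrite (gpP n0 m k (ltnW mn) km).
  + move=> n j m k k' jn mj km k'n; apply: leq_trans (rS n j k' jn k'n).
    by rewrite leq_max (gpP j m k mj km).
- apply: (@cond0_leI q r n1); rewrite ?rt //.
  + by apply: subset_trans rB _; apply: subIsetr.
  + by move=> n u _ nu; apply: rK; right.
  + move=> m k k' mn km /r0; apply: leq_trans; rewrite leq_max.
    by rewrite (gqP n1 m k (ltnW mn) km) orbT.
  + move=> n j m k k' jn mj km k'n; apply: leq_trans (rS n j k' jn k'n).
    by rewrite leq_max (gqP j m k mj km) orbT.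
Qed.

(** A common extension u is decided as (t, B); pulling the forced order back to the ground model
    gives the data that [amalgamate] needs. *)
Lemma embed_compatible p q :
  compatible (two_step_le (@mathias_le Fsigma_filter)) (embed p) (embed q) ->
  compatible cond0_le p q.
Proof.
move=> [u [[pu up] [qu uq]]].
have [F Fu [t [B [FB Eu]]]] := decide_condition u.
have mono f : forces le (sval u).1 (mathias_le (sval u).2 (embed_name f)) ->
    sval (cond_Fsigma f) `<=` sval (sval u).1 ->
    [/\ sval (cond_Fsigma f) `<=` sval F, (stem f `<=` t)%fset &
      forall k, k \in t -> k \notin stem f -> cond0_int f k].
  move=> uf fu.
  have Ff : forces le F (mathias_le (sval u).2 (embed_name f)).
    by move=> G GF; apply: uf; apply: le_trans GF Fu.
  have [st sint _] := forces_mathias_le_inv le_refl le_trans Eu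
    (feq_refl le_refl _ _) Ff.
  by split => //; [apply: subset_trans fu Fu|apply/fsubsetP].
have [pF stp intp] := mono p up pu.
have [qF stq intq] := mono q uq qu.
exact: amalgamate pF qF stp intp stq intq.
Qed.

Theorem theorem3p3 :
  exists i : cond0 -> two_step Fsigma_filter_le (mathias_cond generic_name),
    dense_embedding cond0_le
      (two_step_le (le := Fsigma_filter_le) (Q := mathias_cond generic_name)
         (@mathias_le Fsigma_filter)) i.
Proof.
exists embed; split.
- by move=> p q; apply: embed_le.
- by move=> p q; apply: contra_not; apply: embed_compatible.
- exact: embed_dense.
Qed.
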